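(* Let $n=1+4K$ be a prime, with $K$ a positive integer. There exist positive integers $a,d,z$ with $d\mid a^2$ and $$(4a-1)z-d-na=0$$ if and only if there exist positive integers $a,\mu$ and a positive divisor $d$ of $a^2$ such that $$K=\mu(4a-1)-a-d.$$ *)

(* Defs.v *)
From mathcomp Require Export all_boot all_order all_algebra.

Set Implicit Arguments.
Unset Strict Implicit.
Unset Printing Implicit Defensive.

(* Main.v *)
(** For fixed [a] and [d] the two equations are the same one, via the
    substitution [z = mu + K]: when [n = 1 + 4 K],
    [(4 a - 1)(mu + K) - d - n a = mu (4 a - 1) - a - d - K].
    It preserves positivity because [(4 a - 1) (z - K) = K + a + d > 0]. *)

Require Import Defs.
From mathcomp Require Import all_boot all_order all_algebra.
From mathcomp Require Import zify.
Import GRing.Theory Num.Theory.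
Local Open Scope ring_scope.

Theorem mainTheorem4 (n K : nat) (hK : (0 < K)%N) (hn : n = (1 + 4 * K)%N)
    (pn : prime n) :
  (exists a d z : nat,
      [/\ (0 < a)%N, (0 < d)%N, (0 < z)%N, (d %| a ^ 2)%N
        & (4 * a%:Z - 1) * z%:Z - d%:Z - n%:Z * a%:Z = 0])
  <->
  (exists a mu d : nat,
      [/\ (0 < a)%N, (0 < mu)%N, (0 < d)%N, (d %| a ^ 2)%N
        & K%:Z = mu%:Z * (4 * a%:Z - 1) - a%:Z - d%:Z]).
Proof.
have hnZ : n%:Z = 1 + 4 * K%:Z by lia.
split=> [[a [d [z [ha hd hz hda eq_z]]]] | [a [mu [d [ha hmu hd hda eq_K]]]]].
(* If [z <= K], then [(4a-1)z <= (4a-1)K < 4aK + a + d], against [eq_z]. *)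
- have ltKz : (K < z)%N by clear hda pn hn; nia.
  exists a, (z - K)%N, d; split=> //; first by rewrite subn_gt0.
  (* The witness is a truncated difference; [K <= z] makes its cast the integer [z - K]. *)
  rewrite -subzn ?(ltnW ltKz) //.
  (* After expansion both sides are linear in the monomials [a*z] and [a*K], so [lia] suffices. *)
  by move: eq_z; rewrite hnZ; clear; lia.
- exists a, d, (mu + K)%N; split=> //; first by rewrite addn_gt0 hmu.
  (* The [4aK] from [(4a-1)(mu+K)] cancels the one from [n*a]. *)
  by move: eq_K; rewrite hnZ PoszD; clear; lia.
Qed.
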